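(* Let $\hat h:\mathbb R^n\to\mathbb R\cup\{\infty\}$ be a Legendre kernel and let $\varphi:\mathbb R^n\to\mathbb R\cup\{\infty\}$ be proper, lsc and $\hat h$-prox-bounded. Then: (i) If $x_\star\in\operatorname{int}\operatorname{dom}\hat h$ is a local minimum for $\varphi$, then it is a nondegenerate fixed point of $\operatorname{prox}_{\gamma\varphi}^{\hat h}$ (that is, $\operatorname{prox}_{\gamma\varphi}^{\hat h}(x_\star)=\{x_\star\}$) for any $\gamma>0$ small enough. (ii) Conversely, for $\gamma\in(0,\gamma_\varphi^{\hat h})$, any nondegenerate fixed point $x_\star$ of $\operatorname{prox}_{\gamma\varphi}^{\hat h}$ is a local minimum for $\varphi$ if and only if it is a local minimum for $\varphi^{\hat h/\gamma}$. Moreover, provided that $\hat h$ is strongly convex in a neighborhood of $x_\star$, $x_\star$ is a strong local minimum for $\varphi$ if and only if it is a strong local minimum for $\varphi^{\hat h/\gamma}$.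
   Context: A Legendre kernel is a proper, lsc, convex function $\hat h:\mathbb R^n\to\mathbb R\cup\{\infty\}$ with $\operatorname{int}\operatorname{dom}\hat h\ne\emptyset$, $\hat h\in\mathcal C^1(\operatorname{int}\operatorname{dom}\hat h)$, that is strictly convex, essentially smooth ($\|\nabla \hat h(x_k)\|\to\infty$ for every sequence in $\operatorname{int}\operatorname{dom}\hat h$ converging to a boundary point of $\operatorname{dom}\hat h$), and $1$-coercive ($\lim_{\|x\|\to\infty}\hat h(x)/\|x\|=\infty$). Bregman distance: $\mathrm D_{\hat h}(x,y)=\hat h(x)-\hat h(y)-\langle\nabla \hat h(y),x-y\rangle$ if $y\in\operatorname{int}\operatorname{dom}\hat h$, and $\infty$ otherwise. $\operatorname{prox}_{\gamma\varphi}^{\hat h}(x)=\operatorname*{argmin}_{z}\{\varphi(z)+\frac1\gamma \mathrm D_{\hat h}(z,x)\}$ (defined for $x\in\operatorname{int}\operatorname{dom}\hat h$) and $\varphi^{\hat h/\gamma}(x)=\inf_z\{\varphi(z)+\frac1\gamma \mathrm D_{\hat h}(z,x)\}$. $\varphi$ is $\hat h$-prox-bounded if there is $\gamma>0$ with $\varphi^{\hat h/\gamma}(x)>-\infty$ for some $x\in\mathbb R^n$; the threshold $\gamma_\varphi^{\hat h}$ is the supremum of all such $\gamma$. $x_\star\in\operatorname{dom}F$ is a local minimum of $F$ if $F(x)\ge F(x_\star)$ for all $x$ near $x_\star$, and a strong local minimum if for some $\mu>0$, $F(x)\ge F(x_\star)+\frac\mu2\|x-x_\star\|^2$ for all $x$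 near $x_\star$.
   Formalization: In prox-boundedness and its threshold, the point x with envelope value above −∞ is required to lie in int dom ĥ; with any x in R^n allowed, the condition is void when int dom ĥ ≠ R^n and (i) fails (e.g. ĥ = x ln x, φ with a local minimum at 1 and equal to −x³ for large x). *)

(* Defs.v *)
From mathcomp Require Import all_boot all_order all_algebra.
From mathcomp Require Import all_classical all_reals all_analysis.
Set Implicit Arguments.
Unset Strict Implicit.
Unset Printing Implicit Defensive.
Import Order.TTheory GRing.Theory Num.Theory.
Import numFieldNormedType.Exports.
Local Open Scope classical_set_scope.
Local Open Scope ring_scope.
Local Open Scope ereal_scope.

Section Euclidean.
Context {R : realType} {n : nat}.
Implicit Types x y : 'rV[R]_n.

Definition inner x y : R := (\sum_i x ord0 i * y ord0 i)%R.

(* The library norm on ['rV[R]_n] is the sup norm; it induces the same topology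
   as the Euclidean norm, but the quantitative notions below use the latter. *)
Definition enorm x : R := Num.sqrt (inner x x).

Definition grad (f : 'rV[R]_n -> R) x : 'rV[R]_n :=
  \row_i 'D_(delta_mx ord0 i) f x.

End Euclidean.

Section ExtendedValued.
Context {R : realType} {n : nat}.
Implicit Types (f : 'rV[R]_n -> \bar R) (A : set 'rV[R]_n).

Definition dom f : set 'rV[R]_n := [set x | f x < +oo].

Definition proper_function f : Prop := (forall x, -oo < f x) /\ dom f !=set0.

(* Used for functions avoiding [-oo], so that no [+oo - oo] occurs. *)
Definition convex_on A f : Prop :=
  forall x y (t : R), A x -> A y -> (0 < t < 1)%R ->
    f (t *: x + (1 - t) *: y)%R <= t%:E * f x + (1 - t)%:E * f y.

Definition strictly_convex f : Prop :=
  forall x y (t : R), dom f x -> dom f y -> x <> y -> (0 < t < 1)%R ->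
    f (t *: x + (1 - t) *: y)%R < t%:E * f x + (1 - t)%:E * f y.

Definition strongly_convex_on A f : Prop :=
  exists2 s : R, (0 < s)%R &
    convex_on A (fun x => f x - (s / 2 * enorm x ^+ 2)%:E).

(* Library balls are cubes (sup norm), hence convex neighborhoods. *)
Definition strongly_convex_near f (x : 'rV[R]_n) : Prop :=
  exists2 r : R, (0 < r)%R & strongly_convex_on (ball x r) f.

(* On the interior of the domain of a proper [f], [fine \o f] is [f] itself. *)
Definition egrad f : 'rV[R]_n -> 'rV[R]_n := grad (fine \o f).

Definition C1_on_int_dom f : Prop :=
  (forall x, (dom f)° x -> differentiable (fine \o f) x) /\
  (forall x, (dom f)° x -> {for x, continuous (egrad f)}).

Definition essentially_smooth f : Prop :=
  forall (u : nat -> 'rV[R]_n) (x : 'rV[R]_n),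
    (forall k, (dom f)° (u k)) ->
    (closure (dom f) `\` (dom f)°) x ->
    u @ \oo --> x ->
    (fun k => enorm (egrad f (u k))) @ \oo --> +oo%R.

Definition one_coercive f : Prop :=
  forall M : R, exists r : R, forall x, (r < enorm x)%R ->
    M%:E < f x * ((enorm x)^-1)%:E.

Definition local_min f (xs : 'rV[R]_n) : Prop :=
  dom f xs /\ \forall x \near xs, f xs <= f x.

Definition strong_local_min f (xs : 'rV[R]_n) : Prop :=
  dom f xs /\
  exists2 mu : R, (0 < mu)%R &
    \forall x \near xs, f xs + (mu / 2 * enorm (x - xs)%R ^+ 2)%:E <= f x.

Definition argmin f : set 'rV[R]_n := [set z | forall w, f z <= f w].

End ExtendedValued.

Record legendre_kernel {R : realType} {n : nat} (h : 'rV[R]_n -> \bar R) :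
    Prop := LegendreKernel {
  legendre_proper : proper_function h;
  legendre_lsc : lower_semicontinuous h;
  legendre_convex : convex_on setT h;
  legendre_int_dom : (dom h)° !=set0;
  legendre_C1 : C1_on_int_dom h;
  legendre_strictly_convex : strictly_convex h;
  legendre_essentially_smooth : essentially_smooth h;
  legendre_one_coercive : one_coercive h
}.

Section Bregman.
Context {R : realType} {n : nat}.
Implicit Types (h phi : 'rV[R]_n -> \bar R) (g : R).

Definition bregman h (x y : 'rV[R]_n) : \bar R :=
  if `[< (dom h)° y >] then h x - h y - (inner (egrad h y) (x - y)%R)%:E
  else +oo.

Definition prox_objective h g phi (x z : 'rV[R]_n) : \bar R :=
  phi z + (g^-1)%:E * bregman h z x.

Definition prox h g phi (x : 'rV[R]_n) : set 'rV[R]_n :=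
  argmin (prox_objective h g phi x).

Definition envelope h g phi (x : 'rV[R]_n) : \bar R :=
  ereal_inf (range (prox_objective h g phi x)).

(* The witness has to lie in the interior of [dom h]: elsewhere the envelope is
   identically [+oo], and the condition would be void as soon as
   [dom h] is not the whole space. *)
Definition prox_bounded_with h phi g : Prop :=
  (0 < g)%R /\ exists2 x, (dom h)° x & -oo < envelope h g phi x.

Definition prox_bounded h phi : Prop := exists g, prox_bounded_with h phi g.

Definition prox_threshold h phi : \bar R :=
  ereal_sup [set g%:E | g in prox_bounded_with h phi].

(* [prox] is only meaningful on the interior of [dom h]. *)
Definition nondegenerate_fixed_point h g phi (x : 'rV[R]_n) : Prop :=
  (dom h)° x /\ prox h g phi x = [set x].

End Bregman.

(* Main.v *)
(* Both parts rest on one estimate: an extended-valued lsc function that exceeds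
   a number a on a closed set C and is at least a + 1 + |z| for |z| large is at
   least a + k (1 + |z|) on C for some k > 0.  For D_h(., p), whose growth comes
   from the 1-coercivity of h, it shows that D_h(., p) / gamma eventually
   dominates the lower bound on phi given by prox-boundedness, hence (i).  For
   phi + D_h(., p) / gamma, which grows because gamma is below the threshold, it
   gives a margin off any neighbourhood of the fixed point p that absorbs the
   perturbation D_h(z, x) - D_h(z, p) = o(1) (1 + |z|) as x -> p.  So near p only
   points z close to p matter in the envelope, and there phi(z) + D_h(z, x) / gamma
   inherits the growth of phi, combined in the strong case with that of D_h(z, x)
   through |x - p|^2 <= 2 |z - p|^2 + 2 |z - x|^2. *)
Require Import Defs.
From mathcomp Require Import all_boot all_order all_algebra.
From mathcomp Require Import all_classical all_reals all_analysis.
From mathcomp Require Import ring lra.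
Import Order.TTheory GRing.Theory Num.Theory.
Import numFieldNormedType.Exports.
Local Open Scope classical_set_scope.
Local Open Scope ring_scope.

(** * Euclidean versus sup norm, one-sided derivatives, lower semicontinuity *)

Section EuclideanSpace.
Context {R : realType} {n : nat}.
Implicit Types (x y z v : 'rV[R]_n) (f : 'rV[R]_n -> R) (F : 'rV[R]_n -> \bar R).

Lemma near_dist_lt x (e : R) : 0 < e -> \forall y \near x, `|x - y| < e.
Proof. by move=> e0; apply/nbhs_normP; exists e. Qed.

Lemma coord_le_norm x i : `|x ord0 i| <= `|x|.
Proof.
rewrite {2}/Num.norm /= mx_normrE.
exact: (le_bigmax _ (fun ij : 'I_1 * 'I_n => `|x ij.1 ij.2|) (ord0, i)).
Qed.

Lemma inner_ge0 x : 0 <= inner x x.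
Proof. by apply: sumr_ge0 => i _; exact: sqr_ge0. Qed.

Lemma sqr_enorm x : enorm x ^+ 2 = inner x x.
Proof. by rewrite sqr_sqrtr// inner_ge0. Qed.

Lemma normr_le_enorm x : `|x| <= enorm x.
Proof.
rewrite {1}/Num.norm /= mx_normrE; apply: bigmax_le; first exact: sqrtr_ge0.
move=> [i0 i] _ /=; rewrite (ord1 i0) -sqrtr_sqr ler_sqrt ?inner_ge0//.
by rewrite /inner (bigD1 i)//= expr2 lerDl sumr_ge0// => j _; exact: sqr_ge0.
Qed.

Lemma normr_inner_le x y : `|inner x y| <= n%:R * (`|x| * `|y|).
Proof.
apply: (le_trans (ler_norm_sum _ _ _)).
rewrite mulr_natl -[X in _ *+ X](card_ord n) -sumr_const; apply: ler_sum => i _.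
by rewrite normrM ler_pM// coord_le_norm.
Qed.

Lemma sqr_enorm_le x : enorm x ^+ 2 <= n%:R * `|x| ^+ 2.
Proof.
by rewrite sqr_enorm (le_trans (ler_norm _))// (le_trans (normr_inner_le _ _)).
Qed.

Lemma innerDr x y z : inner x (y + z) = inner x y + inner x z.
Proof. by rewrite -big_split; apply: eq_bigr => i _; rewrite mxE mulrDr. Qed.

Lemma innerZr a x y : inner x (a *: y) = a * inner x y.
Proof. by rewrite /inner mulr_sumr; apply: eq_bigr => i _; rewrite mxE mulrCA. Qed.

Lemma innerBr x y z : inner x (y - z) = inner x y - inner x z.
Proof. by rewrite innerDr -scaleN1r innerZr mulN1r. Qed.

Lemma innerC x y : inner x y = inner y x.
Proof. by apply: eq_bigr => i _; rewrite mulrC. Qed.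

Lemma innerBl x y z : inner (x - y) z = inner x z - inner y z.
Proof. by rewrite innerC innerBr !(innerC z). Qed.

Lemma sqr_enormD_le x y : enorm (x + y) ^+ 2 <= 2 * (enorm x ^+ 2 + enorm y ^+ 2).
Proof.
rewrite !sqr_enorm /inner -big_split /= mulr_sumr; apply: ler_sum => i _.
rewrite mxE -subr_ge0 (_ : _ - _ = (x ord0 i - y ord0 i) ^+ 2) ?sqr_ge0//; ring.
Qed.

Lemma sqr_enormN x : enorm (- x) ^+ 2 = enorm x ^+ 2.
Proof. by rewrite !sqr_enorm; apply: eq_bigr => i _; rewrite mxE mulrNN. Qed.

Lemma derive_inner_grad f x v :
  differentiable f x -> 'D_v f x = inner (grad f x) v.
Proof.
move=> df; rewrite deriveE// {1}(row_sum_delta v) linear_sum /inner.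
by apply: eq_bigr => i _; rewrite linearZ /= mxE deriveE// mulrC.
Qed.

(** Dividing the convexity bound by [t] shows that the difference quotient minus [s * t] is at most
    [b - f x - s]; let [t] tend to 0 from the right. The defect [s] carries strong convexity;
    [s = 0] is the usual gradient inequality. *)
Lemma derive_le_of_convex f x v (b s : R) : derivable f x v ->
  (forall t, 0 < t < 1 ->
     f (x + t *: v) <= t * b + (1 - t) * f x - s * (t * (1 - t))) ->
  'D_v f x <= b - f x - s.
Proof.
move=> /(@cvg_dnbhs_at_right R R) fx fconv.
have ct : (fun t : R => s * t) @ 0^'+ --> s * 0.
  by apply: cvg_at_right_filter; apply: cvgMr; exact: cvg_id.
have := cvgB fx ct; rewrite mulr0 subr0 => fxs.
rewrite /derive; apply: (cvgr_to_le (fxs _)); near=> t => /=.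
have t0 : 0 < t by near: t; exact: nbhs_right_gt.
have t1 : t < 1 by near: t; exact: nbhs_right_lt.
have := fconv t; rewrite t0 t1 => /(_ isT) ft.
rewrite -[_ - _ <= _](ler_pM2l t0) /shift /= mulrBr addrC.
rewrite [_ *: _]/(_ * _) mulVKf ?gt_eqF// (addrC (t *: v)); lra.
Unshelve. all: by end_near. Qed.

(** On the part of [C] in a large closed ball, lower semicontinuity leaves room above [a] near each
    point, so a small [k] works there, and compactness makes one [k] serve everywhere. Outside the
    ball the assumed slope 1 suffices once [k < 1]. *)
Lemma lsc_linear_growth F (C : set 'rV[R]_n) (a M : R) :
  lower_semicontinuous F -> closed C ->
  (forall z, C z -> a%:E < F z)%E ->
  (forall z, M <= `|z| -> ((a + (1 + `|z|))%:E <= F z)%E) ->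
  exists2 k, 0 < k & forall z, C z -> ((a + k * (1 + `|z|))%:E <= F z)%E.
Proof.
move=> lscF clC Fa Fcoer.
pose K := C `&` closed_ball (0 : 'rV[R]_n) (Num.max M 1).
have M0 : 0 < Num.max M 1 by rewrite lt_max ltr01 orbT.
have cK : compact K.
  apply: bounded_closed_compact; last first.
    by apply: closedI => //; exact: closed_ball_closed.
  exists (Num.max M 1); split; first exact: num_real.
  move=> r Mr z [_].
  rewrite closed_ballE// /closed_ball_ /= sub0r normrN.
  by move=> /le_trans; apply; exact: ltW.
have : \forall k \near 0^'+, K `<=` (fun z => (a + k * (1 + `|z|))%:E <= F z)%E.
  apply: (iffLR (compact_near_coveringP _) cK) => z0 [Cz0 _].
  have [r ar rF] : exists2 r, a < r & (r%:E < F z0)%E.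
    have := Fa _ Cz0; case: (F z0) => [v||]//.
      by rewrite lte_fin => av; exists ((a + v) / 2); rewrite ?lte_fin; lra.
    by move=> _; exists (a + 1); rewrite ?ltry//; lra.
  have [V nV VF] := lscF _ _ rF.
  have z20 : 0 < 2 + `|z0| by rewrite ltr_pwDl.
  (* Within distance 1 of [z0], [1 + |z|] is at most [2 + |z0|], so a [k] below this quotient keeps
     [a + k * (1 + |z|)] under [r]. *)
  have d0 : 0 < (r - a) / (2 + `|z0|) by rewrite divr_gt0 ?subr_gt0.
  near=> z k => /=.
  have Vz : V z by near: z.
  apply: ltW; apply: le_lt_trans (VF _ Vz); rewrite lee_fin.
  have zz0 : `|z| <= 1 + `|z0|.
    have zd : `|z0 - z| < 1 by near: z; exact: near_dist_lt.
    by rewrite -[z](subrK z0) (le_trans (ler_normD _ _))// lerD2r distrC ltW.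
  have k0 : 0 < k by near: k; exact: nbhs_right_gt.
  have : k < (r - a) / (2 + `|z0|) by near: k; exact: nbhs_right_lt.
  rewrite ltr_pdivlMr// => kz.
  have : k * (1 + `|z|) <= k * (2 + `|z0|) by rewrite ler_pM2l//; lra.
  lra.
move=> Kk; near (0 : R)^'+ => k; exists k; first by near: k; exact: nbhs_right_gt.
move=> z Cz; have [zM|Mz] := leP `|z| (Num.max M 1).
  have : K `<=` (fun z => (a + k * (1 + `|z|))%:E <= F z)%E by near: k.
  by apply; split => //; rewrite closed_ballE// /closed_ball_ /= sub0r normrN.
have k1 : k < 1 by near: k; exact: nbhs_right_lt.
apply: le_trans (Fcoer z _); last by rewrite (le_trans _ (ltW Mz))// le_max lexx.
by rewrite lee_fin lerD2l ler_piMl// ?ltW// ltr_wpDr.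
Unshelve. all: by end_near. Qed.

Lemma lsc_add F G : lower_semicontinuous F -> lower_semicontinuous G ->
  (forall x, -oo < F x)%E -> (forall x, -oo < G x)%E ->
  lower_semicontinuous (fun x => F x + G x)%E.
Proof.
move=> lF lG F0 G0 x a aFG.
(* Splitting [a] as [b + (a - b)] lets each summand use its own neighbourhood; if both values are
   finite, the slack is shared equally. *)
have [b bF abG] : exists2 b, (b%:E < F x)%E & ((a - b)%:E < G x)%E.
  move: aFG (F0 x) (G0 x); case: (F x) => [u||]//; case: (G x) => [v||]//=.
  - rewrite -EFinD lte_fin => auv _ _.
    by exists (u - (u + v - a) / 2); rewrite lte_fin; lra.
  - by move=> _ _ _; exists (u - 1); rewrite ?ltry// lte_fin; lra.
  - by move=> _ _ _; exists (a - v + 1); rewrite ?ltry// lte_fin; lra.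
  - by move=> _ _ _; exists 0; rewrite ?ltry.
have [U nU UF] := lF _ _ bF; have [V nV VG] := lG _ _ abG.
exists (U `&` V); first exact: filterI.
move=> y [/UF Fy /VG Gy]; rewrite -[a](subrKC b) EFinD.
exact: lteD.
Qed.

Lemma lsc_scale F (k : R) : 0 < k -> lower_semicontinuous F ->
  lower_semicontinuous (fun x => k%:E * F x)%E.
Proof.
move=> k0 lF x a; rewrite -lte_pdivrMl// -EFinM => /lF[V nV VF].
by exists V => // y /VF; rewrite EFinM lte_pdivrMl.
Qed.

Lemma lsc_continuous f : continuous f -> lower_semicontinuous (EFin \o f).
Proof.
move=> cf x a; rewrite /= lte_fin => afx; exists [set y | a < f y].
  exact: (@cvgr_gt _ _ (nbhs x) _ f (f x) (cf x) a afx).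
by move=> y; rewrite /= lte_fin.
Qed.

Lemma continuous_inner x : continuous (inner x).
Proof.
move=> y; apply/(@cvgrPdist_le R R _ (nbhs y) (nbhs_filter y)) => e e0; near=> z.
rewrite -innerBr (le_trans (normr_inner_le _ _))// mulrA.
have A0 : 0 < 1 + n%:R * `|x| by rewrite ltr_pwDl.
rewrite (@le_trans _ _ ((1 + n%:R * `|x|) * `|y - z|)) ?ler_wpM2r ?lerDr//.
rewrite -ler_pdivlMl// ltW//; near: z.
by apply: near_dist_lt; rewrite mulr_gt0 ?invr_gt0.
Unshelve. all: by end_near. Qed.

End EuclideanSpace.

(** * The Bregman distance of a Legendre kernel *)

Section BregmanDistance.
Context {R : realType} {n : nat}.
Implicit Types (x y z : 'rV[R]_n).

Lemma sqr_enorm_convex x z (t : R) :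
  enorm (t *: z + (1 - t) *: x) ^+ 2 =
  t * enorm z ^+ 2 + (1 - t) * enorm x ^+ 2 - t * (1 - t) * enorm (z - x) ^+ 2.
Proof.
rewrite !sqr_enorm /inner !mulr_sumr -big_split -sumrB /=.
by apply: eq_bigr => i _; rewrite !mxE; ring.
Qed.

Lemma dom_fineE (f : 'rV[R]_n -> \bar R) x :
  proper_function f -> dom f x -> f x = (fine (f x))%:E.
Proof. by move=> [f0 _] fx; rewrite fineK// fin_numElt f0. Qed.

Lemma interior_dom (f : 'rV[R]_n -> \bar R) x : (dom f)° x -> dom f x.
Proof. exact: nbhs_singleton. Qed.

Lemma not_domE (f : 'rV[R]_n -> \bar R) x : ~ dom f x -> f x = +oo%E.
Proof. by rewrite /dom /= ltey => /negP; rewrite negbK => /eqP. Qed.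

Context (h : 'rV[R]_n -> \bar R) (legendre_h : legendre_kernel h).

(** Real-valued, so that estimates become real arithmetic. As [fine] sends infinities to 0, it
    stands for [bregman] only under [dom h z] and [(dom h)° x]. *)
Definition bregman_fine z x : R :=
  fine (h z) - fine (h x) - inner (egrad h x) (z - x).

Let proper_h := legendre_proper legendre_h.

Lemma bregmanE z x : (dom h)° x -> dom h z -> bregman h z x = (bregman_fine z x)%:E.
Proof.
move=> hx hz; rewrite /bregman asboolT// (dom_fineE _ _ proper_h hz).
by rewrite (dom_fineE _ _ proper_h (interior_dom _ _ hx)).
Qed.

Lemma bregman_not_dom z x : (dom h)° x -> ~ dom h z -> bregman h z x = +oo%E.
Proof.
move=> hx hz; rewrite /bregman asboolT// (not_domE _ _ hz).
by rewrite (dom_fineE _ _ proper_h (interior_dom _ _ hx)).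
Qed.

(** The bound along the segment limits the derivative of [h] at [x] towards [z], which is the inner
    product in the Bregman distance. It is used with [c = 0] for convexity and
    [c = s / 2 * enorm (z - x) ^+ 2] for strong convexity. *)
Lemma bregman_fine_ge (c : R) z x : (dom h)° x -> dom h z ->
  (forall t, 0 < t < 1 -> (h (t *: z + (1 - t) *: x)
     <= (t * fine (h z) + (1 - t) * fine (h x) - c * (t * (1 - t)))%:E)%E) ->
  c <= bregman_fine z x.
Proof.
move=> hx hz hc; have [dh _] := legendre_C1 legendre_h.
have dx := dh _ hx.
suff : 'D_(z - x) (fine \o h) x <= fine (h z) - fine (h x) - c.
  by rewrite derive_inner_grad// /bregman_fine /egrad; lra.
apply: derive_le_of_convex; first exact: diff_derivable.
move=> t t01; have := hc _ t01.
have -> : t *: z + (1 - t) *: x = x + t *: (z - x).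
  by apply/rowP => i; rewrite !mxE; ring.
move=> hxt; rewrite -lee_fin /= -(dom_fineE _ _ proper_h)//.
by rewrite /dom /= (le_lt_trans hxt)// ltry.
Qed.

Lemma bregman_fine_ge0 z x : (dom h)° x -> dom h z -> 0 <= bregman_fine z x.
Proof.
move=> hx hz; apply: bregman_fine_ge => // t t01.
have cvx_h := legendre_convex legendre_h; have := cvx_h z x t I I t01.
rewrite (dom_fineE _ z proper_h hz).
rewrite (dom_fineE _ x proper_h (interior_dom _ _ hx)) -!EFinM -EFinD.
by rewrite mul0r subr0.
Qed.

(** At the midpoint [m] of [z] and [x] the distance to [x] is nonnegative, yet strict convexity puts
    it strictly below half the distance from [z] to [x]. *)
Lemma bregman_fine_gt0 z x : (dom h)° x -> dom h z -> z <> x ->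
  0 < bregman_fine z x.
Proof.
move=> hx hz zx; have dx := interior_dom _ _ hx.
have t01 : 0 < (2^-1 : R) < 1 by lra.
have scvx_h := legendre_strictly_convex legendre_h.
have := scvx_h z x 2^-1 hz dx zx t01.
set m := _ + _ => hm.
have dm : dom h m.
  apply: lt_trans hm _.
  by rewrite (dom_fineE _ z proper_h hz) (dom_fineE _ x proper_h dx) ltry.
have := bregman_fine_ge0 m x hx dm.
move: hm; rewrite (dom_fineE _ m proper_h dm) (dom_fineE _ z proper_h hz).
rewrite (dom_fineE _ x proper_h dx) -!EFinM -EFinD lte_fin.
rewrite /bregman_fine (_ : m - x = 2^-1 *: (z - x)); last first.
  by apply/rowP => i; rewrite !mxE; field.
by rewrite innerZr; lra.
Qed.

Lemma bregman_fine_xx x : bregman_fine x x = 0.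
Proof. by rewrite /bregman_fine innerBr !subrr. Qed.

Lemma bregman_fine_ge_strong (A : set 'rV[R]_n) (s : R) z x :
  convex_on A (fun x => h x - (s / 2 * enorm x ^+ 2)%:E)%E ->
  A z -> A x -> (dom h)° x -> dom h z ->
  s / 2 * enorm (z - x) ^+ 2 <= bregman_fine z x.
Proof.
move=> hA Az Ax hx hz; apply: bregman_fine_ge => // t t01.
have := hA z x t Az Ax t01.
rewrite (dom_fineE _ z proper_h hz).
rewrite (dom_fineE _ x proper_h (interior_dom _ _ hx)).
rewrite -!EFinB -!EFinM -EFinD leeBlDr// -EFinD sqr_enorm_convex.
move=> /le_trans; apply; rewrite lee_fin; lra.
Qed.

(** Changing the base point cancels [h z] and leaves a function affine in [z]. Its coefficients tend
    to 0 because [h] and its gradient are continuous at [x0], whence uniformity in [z] relative to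
    [1 + |z|]. *)
Lemma bregman_fine_near x0 (e : R) : (dom h)° x0 -> 0 < e ->
  \forall x \near x0, forall z,
    bregman_fine z x0 - e * (1 + `|z|) <= bregman_fine z x.
Proof.
move=> hx0 e0; have [dh ch] := legendre_C1 legendre_h.
pose B : R := 1 + n%:R * (`|x0| + `|egrad h x0| + 1).
have n0 : 0 <= n%:R :> R by [].
have nx0 : 0 <= n%:R * `|x0| :> R by exact: mulr_ge0.
have nG0 : 0 <= n%:R * `|egrad h x0| :> R by exact: mulr_ge0.
have B0 : 0 < B by rewrite /B; lra.
(* The bound 1 keeps the gradient at [x] within 1 of the norm at [x0]; [D * B <= e / 2] controls
   both inner products, and the other [e / 2] pays for the variation of [h]. *)
pose D : R := Num.min 1 (e / 2 / B).
have D0 : 0 < D by rewrite lt_min ltr01 !divr_gt0.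
have e20 : 0 < e / 2 by rewrite divr_gt0.
have c1 := @cvgr_dist_lt _ _ _ (nbhs x0) _ _ _
  (differentiable_continuous (dh _ hx0)) _ e20.
have c2 := @cvgr_dist_lt _ _ _ (nbhs x0) _ _ _ (ch _ hx0) _ D0.
near=> x => z.
have d1 : `|fine (h x0) - fine (h x)| < e / 2 by near: x; exact: c1.
have d2 : `|egrad h x0 - egrad h x| < D by near: x; exact: c2.
have d3 : `|x0 - x| < D by near: x; exact: near_dist_lt.
have eqd : bregman_fine z x - bregman_fine z x0 = (fine (h x0) - fine (h x))
   + inner (egrad h x0 - egrad h x) (z - x0) - inner (egrad h x) (x0 - x).
  by rewrite /bregman_fine !innerBl !innerBr; ring.
have i1 : `|inner (egrad h x0 - egrad h x) (z - x0)| <= n%:R * (D * (`|z| + `|x0|)).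
  apply: le_trans (normr_inner_le _ _) _; rewrite ler_wpM2l//.
  by apply: ler_pM => //; [exact: (ltW d2)|exact: ler_normB].
have D1 : D <= 1 by rewrite ge_min lexx.
have i2 : `|inner (egrad h x) (x0 - x)| <= n%:R * ((`|egrad h x0| + 1) * D).
  apply: le_trans (normr_inner_le _ _) _; rewrite ler_wpM2l//.
  apply: ler_pM => //.
  apply: ltW; rewrite -[egrad h x](subKr (egrad h x0)) (le_lt_trans (ler_normB _ _))//.
  by rewrite ltrD2l (lt_le_trans d2).
have DB : D * B <= e / 2 by rewrite -ler_pdivlMr// ge_min lexx orbT.
have z0 : 0 <= `|z| by [].
have i3 : n%:R * (D * (`|z| + `|x0|)) + n%:R * ((`|egrad h x0| + 1) * D)
    <= e / 2 * (1 + `|z|).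
  apply: (@le_trans _ _ (D * B * (1 + `|z|))); last by rewrite ler_wpM2r ?addr_ge0.
  rewrite -mulrA [leLHS](_ : _ = D * (n%:R * (`|z| + `|x0| + `|egrad h x0| + 1)));
    last by ring.
  rewrite ler_wpM2l ?ltW//.
  have nxz : 0 <= n%:R * `|x0| * `|z| by exact: mulr_ge0.
  have nGz : 0 <= n%:R * `|egrad h x0| * `|z| by exact: mulr_ge0.
  by rewrite /B; lra.
have ez : 0 <= e * `|z| by rewrite mulr_ge0// ltW.
move: d1 i1 i2; rewrite ltr_norml !ler_norml => /andP[d1 _] /andP[i1 _] /andP[_ i2].
lra.
Unshelve. all: by end_near. Qed.

Lemma bregman_fine_affine x : exists2 A : R, 0 <= A &
  forall z, `|bregman_fine z x - fine (h z)| <= A * (1 + `|z|).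
Proof.
exists (`|fine (h x)| + `|inner (egrad h x) x| + n%:R * `|egrad h x|).
  by rewrite !addr_ge0// mulr_ge0.
move=> z; have := normr_inner_le (egrad h x) z.
rewrite /bregman_fine innerBr.
rewrite (_ : _ - _ - _ - _ = inner (egrad h x) x - fine (h x) - inner (egrad h x) z);
  last by ring.
move=> hz; apply: le_trans (ler_normB _ _) _.
apply: le_trans (lerD (ler_normB _ _) hz) _.
have ? : 0 <= `|fine (h x)| * `|z| by rewrite mulr_ge0.
have ? : 0 <= `|inner (egrad h x) x| * `|z| by rewrite mulr_ge0.
have ? : 0 <= n%:R * `|egrad h x| by rewrite mulr_ge0.
lra.
Qed.

Lemma legendre_coercive (K : R) : exists M : R, forall z,
  M <= `|z| -> dom h z -> K * (1 + `|z|) <= fine (h z).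
Proof.
(* Slope [2 * |K|] suffices because [1 + |z| <= 2 * |z|] once [|z| >= 1], and the sup norm is below
   the Euclidean one. *)
have [r hr] := legendre_one_coercive legendre_h (2 * `|K|).
exists (Num.max r 1 + 1) => z Mz hz.
have rz : r < `|z|.
  by apply: lt_le_trans Mz; rewrite ltr_pwDr// le_max lexx.
have z1 : 1 <= `|z|.
  by apply: le_trans Mz; rewrite ler_wpDr// le_max lexx orbT.
have ez := normr_le_enorm z.
have e0 : 0 < enorm z by lra.
have := hr _ (lt_le_trans rz ez).
rewrite (dom_fineE _ z proper_h hz) -EFinM lte_fin ltr_pdivlMr// => /ltW.
apply: le_trans; apply: (@le_trans _ _ (`|K| * (1 + `|z|))).
  by rewrite ler_wpM2r ?addr_ge0// ler_norm.
by rewrite (mulrC 2) -mulrA ler_wpM2l//; lra.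
Qed.

Lemma lsc_bregman x : (dom h)° x -> lower_semicontinuous (bregman h ^~ x).
Proof.
move=> hx.
pose a := inner (egrad h x) x - fine (h x).
have -> : bregman h ^~ x = (fun z => h z + (a - inner (egrad h x) z)%:E)%E.
  apply/funext => z; rewrite /bregman asboolT//.
  rewrite (dom_fineE _ x proper_h (interior_dom _ _ hx)) innerBr.
  have [h0 _] := proper_h; have := h0 z; case: (h z) => [u||]// _.
  by rewrite -!EFinB; congr EFin; rewrite /a; ring.
apply: lsc_add;
  [exact: legendre_lsc| |by have [] := proper_h|by move=> z; rewrite ltNyr].
apply: (@lsc_continuous _ _ (fun z => a - inner (egrad h x) z)) => z.
exact: (@cvgB _ R _ (nbhs z) (nbhs_filter z) (fun=> a) _ a _
  (cvg_cst _) (continuous_inner _ z)).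
Qed.

Lemma bregman_fine_growth x (C : set 'rV[R]_n) :
  (dom h)° x -> closed C -> ~ C x ->
  exists2 k : R, 0 < k &
    forall z, C z -> dom h z -> k * (1 + `|z|) <= bregman_fine z x.
Proof.
move=> hx clC Cx.
have [A A0 hA] := bregman_fine_affine x.
(* [A] absorbs the affine gap between the distance and [h]; the extra 1 is the slope required by
   [lsc_linear_growth]. *)
have [M hM] := legendre_coercive (A + 1).
have [||k k0 hk] := lsc_linear_growth (bregman h ^~ x) C 0 M (lsc_bregman _ hx) clC.
- move=> z Cz; have [hz|hz] := pselect (dom h z).
    rewrite bregmanE// lte_fin bregman_fine_gt0//.
    by move=> zx; apply: Cx; rewrite -zx.
  by rewrite bregman_not_dom ?ltry.
- move=> z Mz; have [hz|hz] := pselect (dom h z).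
    rewrite bregmanE// lee_fin.
    have := hA z; rewrite ler_norml => /andP[+ _].
    by have := hM z Mz hz; lra.
  by rewrite bregman_not_dom ?leey.
exists k => // z Cz hz; have := hk z Cz.
by rewrite bregmanE// lee_fin add0r.
Qed.

End BregmanDistance.

(** * The proximal objective: finiteness, growth and stability in the base point *)

Section BregmanProx.
Context {R : realType} {n : nat}.
Implicit Types (x z : 'rV[R]_n) (g : R) (C : set 'rV[R]_n).
Context (h phi : 'rV[R]_n -> \bar R) (legendre_h : legendre_kernel h)
  (proper_phi : proper_function phi) (lsc_phi : lower_semicontinuous phi).

(** Case analysis for lower bounds on the objective: the infinite case is trivial, and the other is
    a real expression with both [phi z] and [h z] finite. *)
Variant objective_spec g x z : \bar R -> Prop :=
| ObjectiveFin of dom phi z & dom h z :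
    objective_spec g x z (fine (phi z) + g^-1 * bregman_fine h z x)%:E
| ObjectivePinfty : objective_spec g x z +oo.

Lemma objectiveP g x z : 0 < g -> (dom h)° x ->
  objective_spec g x z (prox_objective h g phi x z).
Proof.
move=> g0 hx; rewrite /prox_objective.
have [hz|hz] := pselect (dom h z); last first.
  rewrite (bregman_not_dom h legendre_h)// gt0_muley ?lte_fin ?invr_gt0//.
  by rewrite addey ?gt_eqF//; [exact: ObjectivePinfty|have [+ _] := proper_phi; apply].
rewrite (bregmanE h legendre_h)//.
have [fz|fz] := pselect (dom phi z); last first.
  by rewrite (not_domE _ _ fz) -EFinM addye//; exact: ObjectivePinfty.
by rewrite (dom_fineE _ _ proper_phi fz) -EFinM -EFinD; exact: ObjectiveFin.
Qed.

Lemma objective_xx g x : (dom h)° x -> prox_objective h g phi x x = phi x.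
Proof.
move=> hx; rewrite /prox_objective (bregmanE h legendre_h)//; last exact: interior_dom.
by rewrite bregman_fine_xx mule0 adde0.
Qed.

Lemma lsc_objective g x : 0 < g -> (dom h)° x ->
  lower_semicontinuous (prox_objective h g phi x).
Proof.
move=> g0 hx; apply: lsc_add => //.
- by apply: lsc_scale; [rewrite invr_gt0|exact: lsc_bregman].
- by have [] := proper_phi.
- move=> z; have [hz|hz] := pselect (dom h z).
    by rewrite (bregmanE h legendre_h)// -EFinM ltNyr.
  by rewrite (bregman_not_dom h legendre_h)// gt0_muley ?lte_fin ?invr_gt0.
Qed.

Lemma prox_bounded_lower_bound g : prox_bounded_with h phi g ->
  exists c x, forall z, dom phi z -> dom h z ->
    c <= fine (phi z) + g^-1 * bregman_fine h z x.
Proof.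
move=> [g0 [x hx envx]].
have [c cenv] : exists c : R, (c%:E <= envelope h g phi x)%E.
  move: envx; case: (envelope h g phi x) => [c||]// _; first by exists c.
  by exists 0; rewrite leey.
exists c, x => z fz hz; rewrite -lee_fin; apply: (le_trans cenv).
apply: ereal_inf_lbound; exists z => //.
rewrite /prox_objective (bregmanE h legendre_h)//.
by rewrite [in LHS](dom_fineE _ _ proper_phi fz).
Qed.

(** Prox-boundedness at [g1] gives [phi z >= c - D(z, x0) / g1]. Adding [D(z, x) / g] leaves
    [(1/g - 1/g1) * h z] up to terms of order [1 + |z|]; its positive factor and the coercivity of
    [h] give the growth at infinity for [lsc_linear_growth]. *)
Lemma objective_growth g g1 x (v : R) C :
  0 < g -> g < g1 -> prox_bounded_with h phi g1 -> (dom h)° x -> closed C ->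
  (forall z, C z -> v%:E < prox_objective h g phi x z)%E ->
  exists2 k : R, 0 < k & forall z, C z ->
    ((v + k * (1 + `|z|))%:E <= prox_objective h g phi x z)%E.
Proof.
move=> g0 gg1 pb hx clC Cv.
have g10 : 0 < g1 by exact: lt_trans gg1.
have [c [x0 hc]] := prox_bounded_lower_bound _ pb.
have [A A0 hA] := bregman_fine_affine h x.
have [B B0 hB] := bregman_fine_affine h x0.
have ig0 : 0 < g^-1 by rewrite invr_gt0.
have ig10 : 0 < g1^-1 by rewrite invr_gt0.
have w0 : 0 < g^-1 - g1^-1 by rewrite subr_gt0 ltf_pV2.
(* The numerator pays for the slope 1, the two affine errors and the gap between [v] and [c]; the
   denominator is the factor left on [h z]. *)
have [M hM] := legendre_coercive h legendre_h
  ((1 + B / g1 + A / g + `|v - c|) / (g^-1 - g1^-1)).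
apply: (lsc_linear_growth _ _ _ M (lsc_objective _ _ g0 hx) clC Cv) => z Mz.
case: (objectiveP _ _ z g0 hx) => [fz hz|]; last by rewrite leey.
rewrite lee_fin.
have := hM z Mz hz; rewrite mulrAC ler_pdivrMr// => hMz.
have hcz := hc z fz hz.
have /andP[dA _] :
    - (A * (1 + `|z|)) <= bregman_fine h z x - fine (h z) <= A * (1 + `|z|).
  by rewrite -ler_norml.
have /andP[_ dB] :
    - (B * (1 + `|z|)) <= bregman_fine h z x0 - fine (h z) <= B * (1 + `|z|).
  by rewrite -ler_norml.
have {}dA := ler_wpM2l (ltW ig0) dA.
have {}dB := ler_wpM2l (ltW ig10) dB.
have vc := ler_norm (v - c).
have vcz : 0 <= `|v - c| * `|z| by rewrite mulr_ge0.
lra.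
Qed.

Lemma objective_far g g1 x (v : R) C :
  0 < g -> g < g1 -> prox_bounded_with h phi g1 -> (dom h)° x -> closed C ->
  (forall z, C z -> v%:E < prox_objective h g phi x z)%E ->
  exists2 e : R, 0 < e & \forall y \near x, forall z, C z ->
    ((v + e)%:E <= prox_objective h g phi y z)%E.
Proof.
move=> g0 gg1 pb hx clC Cv.
have [k k0 hk] := objective_growth _ _ _ _ _ g0 gg1 pb hx clC Cv.
have k20 : 0 < k / 2 by rewrite divr_gt0.
(* Moving the base point costs at most half of the growth [k * (1 + |z|)]; the other half is at
   least [k / 2]. *)
exists (k / 2) => //; near=> y => z Cz.
have hy : (dom h)° y by near: y; exact: nbhs_interior.
have dy : forall z,
    bregman_fine h z x - g * (k / 2) * (1 + `|z|) <= bregman_fine h z y.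
  by near: y; apply: bregman_fine_near => //; rewrite mulr_gt0.
case: (objectiveP _ _ z g0 hy) => [fz hz|]; last by rewrite leey.
have := hk z Cz; rewrite /prox_objective (bregmanE h legendre_h)//.
rewrite (dom_fineE _ _ proper_phi fz) -EFinM -EFinD !lee_fin /= => hkz.
have ig0 : 0 < g^-1 by rewrite invr_gt0.
have := ler_wpM2l (ltW ig0) (dy z); rewrite mulrBr !mulrA mulVf ?gt_eqF// mul1r => dzy.
have kz : 0 <= k * `|z| by rewrite mulr_ge0// ltW.
lra.
Unshelve. all: by end_near. Qed.


(** * Nondegenerate fixed points and the envelope around them *)

Lemma nondegenerate_fixed_point_gt g x z :
  nondegenerate_fixed_point h g phi x -> z <> x ->
  (phi x < prox_objective h g phi x z)%E.
Proof.
move=> [hx px] zx; rewrite -(objective_xx g x hx) ltNge; apply/negP => zlex.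
have xp : prox h g phi x x by rewrite px.
have : prox h g phi x z by move=> w; exact: le_trans zlex (xp w).
by rewrite px => /zx.
Qed.

(** If [phi x] were infinite, a point of [dom phi] would differ from [x] and have an objective
    strictly above [+oo]. *)
Lemma nondegenerate_fixed_point_dom g x :
  nondegenerate_fixed_point h g phi x -> dom phi x.
Proof.
move=> fpx; apply: contrapT => phix; have [_ [z phiz]] := proper_phi.
have zx : z <> x by move=> zx; apply: phix; rewrite -zx.
have := nondegenerate_fixed_point_gt _ _ _ fpx zx.
by rewrite (not_domE _ _ phix) ltNge leey.
Qed.

Lemma envelope_le g x : (dom h)° x -> (envelope h g phi x <= phi x)%E.
Proof.
by move=> hx; rewrite -(objective_xx g x hx); apply: ereal_inf_lbound; exists x.
Qed.

Lemma envelope_fixed_point g x :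
  nondegenerate_fixed_point h g phi x -> envelope h g phi x = phi x.
Proof.
move=> fpx; have [hx _] := fpx; apply/eqP; rewrite eq_le envelope_le//=.
apply: le_ereal_inf_tmp => _ [z _ <-]; have [->|/eqP zx] := eqVneq z x.
  by rewrite objective_xx.
exact/ltW/nondegenerate_fixed_point_gt.
Qed.

(** The constants are free so that one statement serves both equivalences: all zero for local
    minima, positive for strong ones. The conditions on [c] let the growth of [phi] and of the
    distance each cover one half of the split of [|y - x|^2] at [z]. *)
Lemma envelope_quadratic_growth g x (m s c : R) :
  0 < g -> (g%:E < prox_threshold h phi)%E ->
  nondegenerate_fixed_point h g phi x ->
  0 <= c -> 2 * c <= m -> 2 * c <= g^-1 * s ->
  (exists2 r : R, 0 < r & forall y z, ball x r y -> ball x r z ->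
     (dom h)° y -> dom h z -> s * enorm (z - y) ^+ 2 <= bregman_fine h z y) ->
  (\forall z \near x, phi x + (m * enorm (z - x) ^+ 2)%:E <= phi z)%E ->
  (\forall y \near x,
     envelope h g phi x + (c * enorm (y - x) ^+ 2)%:E <= envelope h g phi y)%E.
Proof.
move=> g0 gthr fpx c0 cm cs [r r0 hr] /nbhs_ballP[r' /= r'0 hr'].
(* The threshold is a supremum, so some admissible [g1] exceeds [g], as [objective_growth]
   demands. *)
have [_ [g1 pb <-]] := ereal_sup_gt gthr; rewrite lte_fin => gg1.
have [hx _] := fpx; have phix := nondegenerate_fixed_point_dom _ _ fpx.
have d0 : 0 < Num.min r r' by rewrite lt_min r0.
have [||e e0 far] := objective_far g g1 x (fine (phi x))
  (~` ball x (Num.min r r')) g0 gg1 pb hx.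
- by rewrite closedC; exact: ball_open.
- move=> z xz; rewrite -(dom_fineE _ _ proper_phi phix).
  apply: nondegenerate_fixed_point_gt => // zx; apply: xz; rewrite zx.
  exact: ballxx.
rewrite (envelope_fixed_point _ _ fpx).
have cn0 : 0 < c * n%:R + 1 by rewrite ltr_wpDl// mulr_ge0.
near=> y.
have hy : (dom h)° y by near: y; exact: nbhs_interior.
have fary : forall z, (~` ball x (Num.min r r')) z ->
  ((fine (phi x) + e)%:E <= prox_objective h g phi y z)%E by near: y.
have yC : ball x (Num.min r r') y by near: y; exact: nbhsx_ballx.
have y1 : `|x - y| < 1 by near: y; exact: near_dist_lt.
(* For far [z] the margin [e] must cover [c * enorm (y - x) ^+ 2], which is at most
   [c * n * |x - y|] when [|x - y| < 1]. The added 1 keeps the denominator positive when [c = 0]. *)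
have y2 : `|x - y| < e / (c * n%:R + 1).
  by near: y; apply: near_dist_lt; exact: divr_gt0.
apply: le_ereal_inf_tmp => _ [z _ <-].
have [zC|zC] := pselect ((~` ball x (Num.min r r')) z).
  apply: le_trans (fary z zC).
  rewrite (dom_fineE _ _ proper_phi phix) -EFinD lee_fin lerD2l.
  move: y2; rewrite ltr_pdivlMr// => /ltW; apply: le_trans.
  have /(ler_wpM2l c0) := sqr_enorm_le (y - x); rewrite distrC => /le_trans; apply.
  have xy0 : 0 <= `|x - y| by [].
  have : `|x - y| ^+ 2 <= `|x - y| by rewrite expr2 ler_piMl// ltW.
  have cn : 0 <= c * n%:R by rewrite mulr_ge0.
  by move=> /(ler_wpM2l cn); lra.
move: zC => /contrapT zC.
have ballS : forall w, ball x (Num.min r r') w -> ball x r w /\ ball x r' w.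
  by move=> w xw; split; apply: le_ball xw; rewrite ge_min lexx ?orbT.
have [zr zr'] := ballS _ zC; have [yr _] := ballS _ yC.
case: (objectiveP _ _ z g0 hy) => [fz hz|]; last by rewrite leey.
have := hr' z zr'.
rewrite (dom_fineE _ _ proper_phi fz) (dom_fineE _ _ proper_phi phix) -!EFinD !lee_fin.
have ig0 : 0 < g^-1 by rewrite invr_gt0.
have := ler_wpM2l (ltW ig0) (hr y z yr zr hy hz).
have : enorm (y - x) ^+ 2 <= 2 * (enorm (z - x) ^+ 2 + enorm (z - y) ^+ 2).
  rewrite -(sqr_enormN (z - y)) (_ : y - x = (z - x) + - (z - y)) ?sqr_enormD_le//.
  by apply/rowP => i; rewrite !mxE; ring.
move=> /(ler_wpM2l c0).
have := ler_wpM2r (sqr_ge0 (enorm (z - x))) cm.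
have := ler_wpM2r (sqr_ge0 (enorm (z - y))) cs.
lra.
Unshelve. all: by end_near. Qed.

(** Inside the ball of local minimality, positivity of the distance makes [x] the strict minimizer.
    Outside, the distance grows at least like [k * (1 + |z|)], and a large [1/g] makes it outweigh
    the possible descent of [phi]. *)
Lemma local_min_nondegenerate_fixed_point x :
  prox_bounded h phi -> (dom h)° x -> local_min phi x ->
  \forall g \near 0^'+, nondegenerate_fixed_point h g phi x.
Proof.
move=> [g0 pb] hx [phix /nbhs_ballP[r /= r0 hr]].
have [g00 _] := pb; have ig0 : 0 < g0^-1 by rewrite invr_gt0.
have [c [x0 hc]] := prox_bounded_lower_bound _ pb.
have [A A0 hA] := bregman_fine_affine h x.
have [B B0 hB] := bregman_fine_affine h x0.
have [||k k0 hk] := bregman_fine_growth h legendre_h x (~` ball x r) hx.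
- by rewrite closedC; exact: ball_open.
- by apply; exact: ballxx.
(* The first term offsets the distance in the lower bound on [phi]. The second, through
   [k * (1 + |z|) <= D(z, x)], pays for moving the base point from [x0] to [x] and for the gap from
   [c] to [phi x]; the final 1 makes the inequality strict. *)
pose K := g0^-1 + ((A + B) / g0 + `|fine (phi x) - c| + 1) / k.
have N0 : 0 <= (A + B) / g0 by rewrite divr_ge0 ?addr_ge0// ltW.
have K0 : 0 < K by rewrite ltr_wpDr// divr_ge0 ?addr_ge0// ltW.
near=> g.
have gg : 0 < g by near: g; exact: nbhs_right_gt.
have gK : g < K^-1 by near: g; apply: nbhs_right_lt; rewrite invr_gt0.
have Kg : K < g^-1 by rewrite -[K]invrK ltf_pV2 ?posrE ?invr_gt0.
have xlt : forall z, z <> x -> (phi x < prox_objective h g phi x z)%E.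
  move=> z zx; case: (objectiveP _ _ z gg hx) => [fz hz|]; last exact: phix.
  rewrite (dom_fineE _ _ proper_phi phix) lte_fin.
  have [zr|zr] := pselect (ball x r z).
    have := hr z zr; rewrite (dom_fineE _ _ proper_phi fz).
    rewrite (dom_fineE _ _ proper_phi phix) lee_fin => /le_lt_trans; apply.
    by rewrite ltrDl mulr_gt0 ?invr_gt0// bregman_fine_gt0.
  have d0 := hk z zr hz.
  have z1 : 0 < 1 + `|z| by rewrite ltr_pwDl.
  have dp : 0 < bregman_fine h z x by apply: lt_le_trans d0; exact: mulr_gt0.
  have hcz := hc z fz hz.
  have /andP[dA _] :
      - (A * (1 + `|z|)) <= bregman_fine h z x - fine (h z) <= A * (1 + `|z|).
    by rewrite -ler_norml.
  have /andP[_ dB] :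
      - (B * (1 + `|z|)) <= bregman_fine h z x0 - fine (h z) <= B * (1 + `|z|).
    by rewrite -ler_norml.
  have dAB : bregman_fine h z x0 <= bregman_fine h z x + (A + B) * (1 + `|z|) by lra.
  have {}dAB := ler_wpM2l (ltW ig0) dAB.
  have gd : K * bregman_fine h z x <= g^-1 * bregman_fine h z x.
    by rewrite ler_wpM2r// ltW.
  have kd : ((A + B) / g0 + `|fine (phi x) - c| + 1) * (1 + `|z|)
      <= ((A + B) / g0 + `|fine (phi x) - c| + 1) / k * bregman_fine h z x.
    rewrite -mulrA ler_wpM2l ?addr_ge0//.
    by rewrite -ler_pdivrMl ?invr_gt0// invrK.
  have vc := ler_norm (fine (phi x) - c).
  have vcz : 0 <= `|fine (phi x) - c| * `|z| by rewrite mulr_ge0.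
  have zz : 0 <= `|z| by [].
  move: gd; rewrite /K mulrDl => gd; lra.
split=> //; apply/seteqP; split => [z zp|z ->].
  apply: contrapT => /xlt; rewrite ltNge => /negP; apply.
  by rewrite -(objective_xx g x hx); exact: zp.
move=> w; rewrite objective_xx//; have [->|/eqP wx] := eqVneq w x.
  by rewrite objective_xx.
exact/ltW/xlt.
Unshelve. all: by end_near. Qed.

End BregmanProx.

Theorem theorem3p7 (R : realType) (n : nat) (h phi : 'rV[R]_n -> \bar R)
    (legendre_h : legendre_kernel h)
    (proper_phi : proper_function phi)
    (lsc_phi : lower_semicontinuous phi)
    (prox_bounded_phi : prox_bounded h phi) :
  (forall xs : 'rV[R]_n, (dom h)° xs -> local_min phi xs ->
     \forall g \near 0^'+, nondegenerate_fixed_point h g phi xs)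
  /\
  (forall g : R, 0 < g -> (g%:E < prox_threshold h phi)%E ->
   forall xs : 'rV[R]_n, nondegenerate_fixed_point h g phi xs ->
     (local_min phi xs <-> local_min (envelope h g phi) xs)
     /\
     (strongly_convex_near h xs ->
      (strong_local_min phi xs <-> strong_local_min (envelope h g phi) xs))).
Proof.
split=> [xs hxs|g g0 gthr xs fp]; first exact: local_min_nondegenerate_fixed_point.
have envxs := envelope_fixed_point h phi legendre_h g xs fp.
have domxs := nondegenerate_fixed_point_dom h phi legendre_h proper_phi g xs fp.
have [hxs _] := fp.
(* With equality at [xs], this passes either kind of minimality from the envelope to [phi], with the
   same [mu]. *)
have env_le : \forall y \near xs, (envelope h g phi y <= phi y)%E.
  near=> y; apply: envelope_le => //.
  by near: y; exact: nbhs_interior.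
have growth := envelope_quadratic_growth h phi legendre_h proper_phi lsc_phi g xs.
split; [split=> -[_ minxs]|move=> [r r0 [s s0 hs]]; split=> -[_ [mu mu0 minxs]]].
- split; first by rewrite /dom /= envxs.
  have := growth 0 0 0 g0 gthr fp; rewrite !mulr0 => /(_ (lexx _) (lexx _) (lexx _)).
  move=> /(_ _ _)/filterS; apply.
  + by move=> y; rewrite mul0r adde0.
  + by exists 1 => // y z _ _ hy hz; rewrite mul0r; exact: bregman_fine_ge0.
  + by apply: filterS minxs => z; rewrite mul0r adde0.
- split=> //; apply: filterS2 minxs env_le => y.
  by rewrite envxs; exact: le_trans.
- split; first by rewrite /dom /= envxs.
  (* Halving the minimum gives both [2 * c <= mu / 2] and [2 * c <= g^-1 * (s / 2)]; the modulus is
     then [2 * c], since strong minimality carries a factor one half. *)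
  pose c := Num.min (mu / 2) (g^-1 * (s / 2)) / 2.
  have c0 : 0 < c by rewrite divr_gt0// lt_min !mulr_gt0 ?invr_gt0.
  exists (2 * c); first exact: mulr_gt0.
  have -> : 2 * c / 2 = c by field.
  apply: (growth (mu / 2) (s / 2) c) => //; first exact: ltW.
  + by rewrite /c mulrC divfK// ge_min lexx.
  + by rewrite /c mulrC divfK// ge_min lexx orbT.
  + by exists r => // y z yr zr hy hz; exact: bregman_fine_ge_strong hs _ _ _ _.
- split=> //; exists mu => //; apply: filterS2 minxs env_le => y.
  by rewrite envxs; exact: le_trans.
Unshelve. all: by end_near. Qed.
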